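(* Let $d,n\geq1$ be integers. Define a $\mathbb{C}[q,q^{-1}]$-linear map $\boldsymbol{\tau}:{\rm Y}_{d,n}(q)\rightarrow\mathbb{C}[q,q^{-1}]$ on the basis $\mathcal{B}$ by $$\boldsymbol{\tau}(t_1^{k_1}\cdots t_n^{k_n}g_w)=\begin{cases}1,&\text{if } w=1\text{ and }k_i\equiv0\bmod d\text{ for all }i=1,\dots,n;\\0,&\text{otherwise.}\end{cases}$$ Then for all $w,w'\in\mathfrak{S}_n$ and $k_1,\dots,k_n,l_1,\dots,l_n\in\mathbb{Z}/d\mathbb{Z}$, $$\boldsymbol{\tau}(t_1^{k_1}\cdots t_n^{k_n}g_wg_{w'}t_1^{l_1}\cdots t_n^{l_n})=\begin{cases}1,&\text{if }w^{-1}=w'\text{ and }k_i+l_i\equiv0\bmod d\text{ for }i=1,\dots,n;\\0,&\text{otherwise.}\end{cases}$$ Moreover, $\boldsymbol{\tau}$ is a symmetrising form on ${\rm Y}_{d,n}(q)$, and the basis dual to $\mathcal{B}$ with respect to $\boldsymbol{\tau}$ is given by $$(t_1^{k_1}\cdots t_n^{k_n}g_w)^\vee=g_{w^{-1}}t_1^{d-k_1}\cdots t_n^{d-k_n}.$$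
   Context: Let $q$ be an indeterminate. The Yokonuma--Hecke algebra ${\rm Y}_{d,n}(q)$ is the associative unital $\mathbb{C}[q,q^{-1}]$-algebra generated by $g_1,\dots,g_{n-1},t_1,\dots,t_n$ subject to: $g_ig_j=g_jg_i$ for $|i-j|>1$; $g_ig_{i+1}g_i=g_{i+1}g_ig_{i+1}$ for $i=1,\dots,n-2$; $t_it_j=t_jt_i$ for all $i,j$; $t_jg_i=g_it_{s_i(j)}$ for all $i,j$, where $s_i$ is the transposition $(i,i+1)$; $t_j^d=1$ for all $j$; and $g_i^2=1+(q-q^{-1})e_ig_i$ for all $i$, where $e_i=\frac1d\sum_{s=0}^{d-1}t_i^st_{i+1}^{-s}$. For $w\in\mathfrak{S}_n$ with reduced expression $w=s_{i_1}\cdots s_{i_r}$, set $g_w:=g_{i_1}\cdots g_{i_r}$ (independent of the reduced expression). By a known result of Juyumaya, $\mathcal{B}=\{t_1^{k_1}\cdots t_n^{k_n}g_w\mid w\in\mathfrak{S}_n,\ k_1,\dots,k_n\in\mathbb{Z}/d\mathbb{Z}\}$ is a $\mathbb{C}[q,q^{-1}]$-basis of ${\rm Y}_{d,n}(q)$. For a commutative ring $R$ and an $R$-algebra $A$ that is free and finitely generated as an $R$-module, a symmetrising form on $A$ is an $R$-linear map $\tau:A\to R$ such that $\tau(aa')=\tau(a'a)$ for all $a,a'\in A$ and the bilinear form $(a,a')\mapsto\tau(aa')$ is non-degenerate, i.e. the determinant of $(\tau(bb'))_{b\in B,b'\in B'}$ is a unit in $R$ for some (hence every) $R$-bases $B,B'$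 of $A$. The dual basis $\{b^\vee\mid b\in B\}$ of a basis $B$ with respect to $\tau$ is determined by $\tau(b^\vee b')=\delta_{b,b'}$ for all $b,b'\in B$. *)

(* Defs.v *)
From HB Require Import structures.
From mathcomp Require Import all_boot all_order all_fingroup all_algebra.
From mathcomp Require Import finmap complex generic_quotient ring_quotient.
From mathcomp Require Import boolp classical_sets reals.
From mathcomp Require Import monalg.

Set Implicit Arguments.
Unset Strict Implicit.
Unset Printing Implicit Defensive.

Import GRing.Theory Num.Theory.
Local Notation "x %:F" := (tofrac x).
Local Open Scope ring_scope.

Section Laurent.
Variable K : fieldType.

(* K[q, q^-1], as the subring of K(q) of all the p / q^m with p in K[q]. *)
Definition laurent_pred : {pred {fraction {poly K}}} :=
  [pred x | `[< exists (p : {poly K}) (m : nat), x = p%:F / ('X)%:F ^+ m >]].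

Local Fact XF_neq0 m : (('X : {poly K})%:F ^+ m : {fraction {poly K}}) != 0.
Proof. by rewrite expf_neq0 // tofrac_eq0 polyX_eq0. Qed.

Local Fact laurent_subring : subring_closed laurent_pred.
Proof.
split.
- by apply/asboolP; exists 1, 0%N; rewrite tofrac1 expr0 divr1.
- move=> x y /asboolP[p [m ->]] /asboolP[p' [m' ->]]; apply/asboolP.
  exists (p * 'X ^+ m' - p' * 'X ^+ m), (m + m')%N.
  rewrite tofracB !tofracM !tofracXn exprD -mulNr addf_div ?XF_neq0 //.
  by rewrite mulNr.
- move=> x y /asboolP[p [m ->]] /asboolP[p' [m' ->]]; apply/asboolP.
  by exists (p * p'), (m + m')%N; rewrite tofracM exprD mulf_div.
Qed.

HB.instance Definition _ := GRing.isSubringClosed.Build {fraction {poly K}}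
  laurent_pred laurent_subring.

Record laurent := Laurent {
  laurent_val : {fraction {poly K}};
  _ : laurent_val \in laurent_pred
}.

HB.instance Definition _ := [isSub for laurent_val].
HB.instance Definition _ := [Choice of laurent by <:].
HB.instance Definition _ := [SubChoice_isSubComNzRing of laurent by <:].

Definition laurent_unit : pred laurent := fun x => `[< exists y, y * x = 1 >].
Definition laurent_inv (x : laurent) : laurent :=
  if pselect (exists y, y * x = 1) is left e then sval (cid e) else x.

Local Fact laurent_mulVx : {in laurent_unit, left_inverse 1 laurent_inv *%R}.
Proof.
by move=> x /asboolP xu; rewrite /laurent_inv; case: pselect => // e; case: cid.
Qed.

Local Fact laurent_unitPl (x y : laurent) : y * x = 1 -> laurent_unit x.
Proof. by move=> xy; apply/asboolP; exists y. Qed.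

Local Fact laurent_invr_out : {in [predC laurent_unit], laurent_inv =1 id}.
Proof.
by move=> x /asboolP xu; rewrite /laurent_inv; case: pselect.
Qed.

HB.instance Definition _ := GRing.ComNzRing_hasMulInverse.Build laurent
  laurent_mulVx laurent_unitPl laurent_invr_out.

Local Fact laurent_q_subproof : ('X)%:F \in laurent_pred.
Proof. by apply/asboolP; exists 'X, 0%N; rewrite expr0 divr1. Qed.

Definition laurent_q : laurent := Laurent laurent_q_subproof.

Lemma laurent_q_unit : laurent_q \is a GRing.unit.
Proof.
have h : (('X)%:F^-1 : {fraction {poly K}}) \in laurent_pred.
  by apply/asboolP; exists 1, 1%N; rewrite tofrac1 expr1 mul1r.
apply/unitrPr; exists (Laurent h); apply: val_inj.
by rewrite /= divff // -['X%:F]expr1 XF_neq0.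
Qed.

End Laurent.

Section Bases.
Variables (R : comUnitRingType) (A : lmodType R) (I : finType) (b : I -> A).

Definition is_basis : Prop :=
  forall a, exists! c : {ffun I -> R}, a = \sum_i c i *: b i.

Definition basis_coord (a : A) : {ffun I -> R} :=
  xget 0 [set c : {ffun I -> R} | a = \sum_i c i *: b i]%classic.

(* When b is a basis, the linear map that sends each b i to f i; see lin_extE
   and lin_ext_scalar. *)
Definition lin_ext (f : I -> R) (a : A) : R := \sum_i basis_coord a i * f i.

Hypothesis b_basis : is_basis.

Lemma basis_coordK a : a = \sum_i basis_coord a i *: b i.
Proof.
have [c [ac _]] := b_basis a.
exact: (@xgetPex _ 0 [set c : {ffun I -> R} | a = \sum_i c i *: b i]%classic (ex_intro _ c ac)).
Qed.

Lemma basis_coord_unique a (c : {ffun I -> R}) :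
  a = \sum_i c i *: b i -> basis_coord a = c.
Proof.
move=> ac; have [c0 [_ c0u]] := b_basis a.
by rewrite -(c0u _ (basis_coordK a)); exact: c0u.
Qed.

Lemma lin_extE f i : lin_ext f (b i) = f i.
Proof.
rewrite /lin_ext (@basis_coord_unique (b i) [ffun j => (j == i)%:R]).
  rewrite (bigD1 i) //= ffunE eqxx mul1r big1 ?addr0 // => j /negPf ji.
  by rewrite ffunE ji mul0r.
rewrite (bigD1 i) //= ffunE eqxx scale1r big1 ?addr0 // => j /negPf ji.
by rewrite ffunE ji scale0r.
Qed.

Lemma lin_ext_scalar f : scalar (lin_ext f).
Proof.
move=> c x y; rewrite /lin_ext mulr_sumr -big_split /=.
rewrite (@basis_coord_unique (c *: x + y)
  [ffun i => c * basis_coord x i + basis_coord y i]).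
  by apply: eq_bigr => i _; rewrite ffunE mulrDl mulrA.
rewrite {1}(basis_coordK x) {1}(basis_coordK y) scaler_sumr -big_split /=.
by apply: eq_bigr => i _; rewrite ffunE scalerDl scalerA.
Qed.

End Bases.

(* The bases b and b' also witness that A is free and finitely generated. *)
Definition symmetrising_form (R : comUnitRingType) (A : algType R) (tau : A -> R) :
    Prop :=
  [/\ scalar tau,
      forall a a', tau (a * a') = tau (a' * a) &
      exists (m : nat) (b b' : 'I_m -> A),
        [/\ is_basis b, is_basis b' &
            \det (\matrix_(i, j) tau (b i * b' j)) \is a GRing.unit]].

Definition dual_basis (R : comUnitRingType) (A : algType R) (tau : A -> R)
    (I : finType) (b b_dual : I -> A) : Prop :=
  [/\ is_basis b, is_basis b_dual &
      forall i j, tau (b_dual i * b j) = (i == j)%:R].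

Section ReducedWords.
Variable n : nat.

Local Fact adj_right_subproof (i : 'I_n.-1) : (i.+1 < n)%N.
Proof. by rewrite -ltn_predRL. Qed.

Definition adj_left (i : 'I_n.-1) : 'I_n := widen_ord (leq_pred n) i.
Definition adj_right (i : 'I_n.-1) : 'I_n := Ordinal (adj_right_subproof i).

Definition adj_tperm (i : 'I_n.-1) : 'S_n := tperm (adj_left i) (adj_right i).

(* Permutations compose from left to right here; the other convention amounts to
   exchanging w and w^-1. *)
Definition word_perm (s : seq 'I_n.-1) : 'S_n := (\prod_(i <- s) adj_tperm i)%g.

Definition reduced_expression (w : 'S_n) (s : seq 'I_n.-1) : Prop :=
  word_perm s = w /\ forall s', word_perm s' = w -> (size s <= size s')%N.

Local Fact adj_generate (w : 'S_n) : exists s, word_perm s = w.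
Proof.
have wcat s s' : word_perm (s ++ s') = (word_perm s * word_perm s')%g.
  by rewrite /word_perm big_cat.
have tp k (x y : 'I_n) : y = (x + k.+1)%N :> nat -> exists s, word_perm s = tperm x y.
  elim: k y => [|k IH] y yE.
    have xlt : (x < n.-1)%N by rewrite ltn_predRL; have := ltn_ord y; rewrite yE addn1.
    exists [:: Ordinal xlt]; rewrite /word_perm big_seq1 /adj_tperm.
    by congr (tperm _ _); apply: val_inj => /=; rewrite ?yE ?addn1.
  have ylt : ((x + k.+1).+1 < n)%N by have := ltn_ord y; rewrite yE addnS.
  have [s sE] := IH (Ordinal (ltnW ylt)) erefl.
  have zlt : (x + k.+1 < n.-1)%N by rewrite ltn_predRL.
  exists ([:: Ordinal zlt] ++ s ++ [:: Ordinal zlt]).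
  rewrite !wcat sE /word_perm !big_seq1.
  have -> : adj_tperm (Ordinal zlt) = tperm (Ordinal (ltnW ylt)) y.
    by rewrite /adj_tperm; congr (tperm _ _); apply: val_inj => /=; rewrite ?yE ?addnS.
  rewrite -[X in (X * _)%g = _]tpermV -conjgE tpermJ.
  rewrite tpermL tpermD //; apply/eqP => /(congr1 val) /= /eqP.
    by rewrite eq_sym -[X in X == _]addn0 eqn_add2l.
  by rewrite yE eq_sym -[X in X == _]addn0 eqn_add2l.
case: (prod_tpermP w) => ts -> _.
elim: ts => [|[x y] ts [s IH]]; first by exists [::]; rewrite /word_perm !big_nil.
suff [s' sE] : exists s', word_perm s' = tperm x y.
  by exists (s' ++ s); rewrite wcat sE IH big_cons.
case: (ltngtP x y) => [xy|yx|/val_inj ->].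
- by apply: (tp (y - x).-1); rewrite prednK ?subn_gt0 // subnKC // ltnW.
- have [] := tp (x - y).-1 y x; last by move=> s' ?; exists s'; rewrite tpermC.
  by rewrite prednK ?subn_gt0 // subnKC // ltnW.
- by exists [::]; rewrite /word_perm big_nil tperm1.
Qed.

Lemma reduced_expression_exists (w : 'S_n) : exists s, reduced_expression w s.
Proof.
pose P m := `[< exists s, word_perm s = w /\ size s = m >].
have exP : exists m, P m.
  by have [s sw] := adj_generate w; exists (size s); apply/asboolP; exists s.
case: (ex_minnP exP) => m /asboolP[s [sw <-]] smin.
by exists s; split => // s' s'w; apply: smin; apply/asboolP; exists s'.
Qed.

(* By Matsumoto's theorem, g_w below does not depend on this choice. *)
Definition reduced_word (w : 'S_n) : seq 'I_n.-1 :=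
  sval (cid (reduced_expression_exists w)).

End ReducedWords.

Inductive two_sided_ideal (A : nzRingType) (P : A -> Prop) : A -> Prop :=
| Ideal_gen x : P x -> two_sided_ideal P x
| Ideal_0 : two_sided_ideal P 0
| Ideal_B x y : two_sided_ideal P x -> two_sided_ideal P y ->
    two_sided_ideal P (x - y)
| Ideal_Ml a x : two_sided_ideal P x -> two_sided_ideal P (a * x)
| Ideal_Mr a x : two_sided_ideal P x -> two_sided_ideal P (x * a).

Section Relators.
Variables (L : comUnitRingType) (q : L) (d n : nat).
Variables (A : lalgType L) (g : 'I_n.-1 -> A) (t : 'I_n -> A).

(* The generators have no inverse in a free algebra; since t_j ^ d = 1 below,
   t_j ^ (d - s) stands for t_j ^ (- s). *)
Definition yh_idem (i : 'I_n.-1) : A :=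
  (d%:R^-1 : L) *:
    \sum_(s < d) t (adj_left i) ^+ s * t (adj_right i) ^+ (d - s).

(* Indices start at 0: g i and t j are the g_(i+1) and t_(j+1) of the usual
   notation. *)
Inductive yh_relator : A -> Prop :=
| Rel_comm_g (i j : 'I_n.-1) : (i.+1 < j)%N || (j.+1 < i)%N ->
    yh_relator (g i * g j - g j * g i)
| Rel_braid (i j : 'I_n.-1) : j = i.+1 :> nat ->
    yh_relator (g i * g j * g i - g j * g i * g j)
| Rel_comm_t (i j : 'I_n) : yh_relator (t i * t j - t j * t i)
| Rel_tg (j : 'I_n) (i : 'I_n.-1) :
    yh_relator (t j * g i - g i * t (adj_tperm i j))
| Rel_order (j : 'I_n) : yh_relator (t j ^+ d - 1)
| Rel_quadratic (i : 'I_n.-1) :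
    yh_relator (g i ^+ 2 - (1 + (q - q^-1) *: (yh_idem i * g i))).

Definition yh_ideal : {pred A} := [pred x | `[< two_sided_ideal yh_relator x >]].

Local Fact yh_ideal_zmod : zmod_closed yh_ideal.
Proof.
split; first by apply/asboolP; apply: Ideal_0.
by move=> x y /asboolP hx /asboolP hy; apply/asboolP; apply: Ideal_B.
Qed.
HB.instance Definition _ := GRing.isZmodClosed.Build A yh_ideal yh_ideal_zmod.

Lemma yh_idealMl a x : x \in yh_ideal -> a * x \in yh_ideal.
Proof. by move=> /asboolP hx; apply/asboolP; apply: Ideal_Ml. Qed.

Lemma yh_idealMr a x : x \in yh_ideal -> x * a \in yh_ideal.
Proof. by move=> /asboolP hx; apply/asboolP; apply: Ideal_Mr. Qed.

Lemma yh_idealBM x x' y y' :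
  x - x' \in yh_ideal -> y - y' \in yh_ideal -> x * y - x' * y' \in yh_ideal.
Proof.
move=> hx hy; have -> : x * y - x' * y' = (x - x') * y + x' * (y - y').
  by rewrite mulrBl mulrBr addrA subrK.
exact: rpredD (yh_idealMr _ hx) (yh_idealMl _ hy).
Qed.

Lemma yh_idealBZ c x x' :
  x - x' \in yh_ideal -> c *: x - c *: x' \in yh_ideal.
Proof. by move=> hx; rewrite -scalerBr -[x - x']mul1r scalerAl yh_idealMl. Qed.

(* A representation in which t_j acts as 1, used to show that 1 is not in the
   ideal. *)
Definition yh_mx : 'M[L]_2 :=
  \matrix_(i, j) (if (i == 0) && (j == 0) then 0
                  else if (i == 1) && (j == 1) then (q - q^-1) * (d%:R^-1 * d%:R)
                  else 1).

Lemma yh_ideal_ker (f : A -> 'M[L]_2) :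
    (forall x y, f (x - y) = f x - f y) -> (forall x y, f (x * y) = f x * f y) ->
    (forall c x, f (c *: x) = c%:M * f x) -> f 1 = 1 ->
    (forall i, f (g i) = yh_mx) -> (forall j, f (t j) = 1) ->
  forall x, x \in yh_ideal -> f x = 0.
Proof.
move=> fB fM fZ f1 fg ft x.
have f0 : f 0 = 0 by rewrite -[X in f X](subrr 0) fB subrr.
have fN v : f (- v) = - f v by rewrite -sub0r fB f0 sub0r.
have fD u v : f (u + v) = f u + f v by rewrite -{1}[v]opprK fB fN opprK.
have fX u k : f (u ^+ k) = f u ^+ k.
  by elim: k => [|k IH]; rewrite ?expr0 ?f1 // !exprS fM IH.
have fe i : f (yh_idem i) = (d%:R^-1 * d%:R)%:M.
  rewrite fZ (big_morph f fD f0).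
  under eq_bigr do rewrite fM !fX !ft !expr1n mulr1.
  by rewrite sumr_const card_ord -mulmxE -raddfMn mul_scalar_mx -scale_scalar_mx.
move=> /asboolP; elim=> {x} [x|||a x _ IH|a x _ IH]; first case.
- by move=> i j _; rewrite fB !fM !fg subrr.
- by move=> i j _; rewrite fB !fM !fg subrr.
- by move=> i j; rewrite fB !fM !ft subrr.
- by move=> j i; rewrite fB !fM !ft mul1r mulr1 subrr.
- by move=> j; rewrite fB fX f1 ft expr1n subrr.
- move=> i; rewrite fB fX fD f1 fZ fM fe fg mulrA -rmorphM expr2.
  apply/matrixP => a b; rewrite -!mulmxE mul_scalar_mx !mxE !big_ord_recl big_ord0 !mxE.
  by case: a => -[|[|//]] ha; case: b => -[|[|//]] hb;
    rewrite /= ?(mulr0n, mulr1n, mulr0, mul0r, mulr1, mul1r, addr0, add0r) subrr.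
- exact: f0.
- by move=> x y _ IHx _ IHy; rewrite fB IHx IHy subrr.
- by rewrite fM IH mulr0.
- by rewrite fM IH mul0r.
Qed.

End Relators.

Lemma yh_relator_lift (L : comUnitRingType) (q : L) (d n : nat) (A B : lalgType L)
    (f : A -> B) (g : 'I_n.-1 -> A) (t : 'I_n -> A) :
    (forall x y, f (x - y) = f x - f y) -> (forall x y, f (x * y) = f x * f y) ->
    (forall c x, f (c *: x) = c *: f x) -> f 1 = 1 ->
  forall y, yh_relator q d (f \o g) (f \o t) y ->
  exists2 x, yh_relator q d g t x & y = f x.
Proof.
move=> fB fM fZ f1.
have f0 : f 0 = 0 by rewrite -[X in f X](subrr 0) fB subrr.
have fN v : f (- v) = - f v by rewrite -sub0r fB f0 sub0r.
have fD u v : f (u + v) = f u + f v by rewrite -{1}[v]opprK fB fN opprK.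
have fX u k : f (u ^+ k) = f u ^+ k.
  by elim: k => [|k IH]; rewrite ?expr0 ?f1 // !exprS fM IH.
have fe i : f (yh_idem d t i) = yh_idem d (f \o t) i.
  rewrite fZ (big_morph f fD f0); congr (_ *: _).
  by apply: eq_bigr => s _; rewrite fM !fX.
move=> y [i j ij|i j ij|i j|j i|j|i]; eexists.
- exact: Rel_comm_g ij.
- by rewrite fB !fM.
- exact: Rel_braid ij.
- by rewrite fB !fM.
- exact: (Rel_comm_t _ _ _ _ i j).
- by rewrite fB !fM.
- exact: (Rel_tg _ _ _ _ j i).
- by rewrite fB !fM.
- exact: (Rel_order _ _ _ _ j).
- by rewrite fB fX f1.
- exact: (Rel_quadratic _ _ _ _ i).
- by rewrite fB fD fX f1 fZ fM fe.
Qed.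

(* Locked so that unification never unfolds a generator. *)
HB.lock Definition malg_gen (L : nzRingType) (I : choiceType) (x : I) :
  {malg L[{fmonom I}]} := << fmu x >>.

Lemma malg_scaleAr (L : comNzRingType) (M : monomType) (c : L) (x y : {malg L[M]}) :
  c *: (x * y) = x * (c *: y).
Proof.
have xC : c *: x = x * c%:MP.
  rewrite malgM_def malgZ_def fgmulgU; apply: eq_bigr => k _.
  by rewrite mulm1 mulrC.
by rewrite scalerAl xC -mulrA mul_malgC.
Qed.

Section YokonumaHecke.
Variables (L : comUnitRingType) (q : L) (d n : nat).

Local Notation yh_gen := ('I_n.-1 + 'I_n)%type.
Local Notation yh_free := {malg L[{fmonom yh_gen}]}.

Definition free_g (i : 'I_n.-1) : yh_free := malg_gen L (inl i).
Definition free_t (j : 'I_n) : yh_free := malg_gen L (inr j).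

Local Notation I := (yh_ideal q d free_g free_t).

Section Nontrivial.

Local Definition yh_rep_gen (x : yh_gen) : 'M[L]_2 := if x is inl _ then yh_mx q d else 1.

Local Definition yh_rep_mon (m : {fmonom yh_gen}) : 'M[L]_2 :=
  \prod_(x <- (m : seq yh_gen)) yh_rep_gen x.

Local Fact yh_rep_mon_mmorph : mmorphism yh_rep_mon.
Proof.
split=> [x y|]; first by rewrite /yh_rep_mon fmM big_cat.
by rewrite /yh_rep_mon fm1 big_nil.
Qed.
HB.instance Definition _ :=
  isMultiplicative.Build {fmonom yh_gen} 'M[L]_2 yh_rep_mon yh_rep_mon_mmorph.

Local Definition yh_rep : yh_free -> 'M[L]_2 := mmap (@scalar_mx L 2) yh_rep_mon.

Local Fact yh_rep_mult : multiplicative yh_rep.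
Proof.
apply: commr_mmap_is_multiplicative => x m m'.
by rewrite /GRing.comm; apply: (esym (scalar_mxC _ _)).
Qed.

Local Fact yh_rep_malg_gen x : yh_rep (malg_gen L x) = yh_rep_gen x.
Proof. by rewrite /yh_rep malg_gen.unlock mmapU mul1r /yh_rep_mon fmU big_seq1. Qed.

Fact yh_ideal_proper : (1 : yh_free) \notin I.
Proof.
apply/negP => h; suff /eqP : yh_rep 1 = 0 by rewrite (snd yh_rep_mult) oner_eq0.
apply: yh_ideal_ker h.
- exact: raddfB.
- exact: (fst yh_rep_mult).
- exact: mmapZ.
- exact: (snd yh_rep_mult).
- by move=> i; exact: yh_rep_malg_gen.
- by move=> j; exact: yh_rep_malg_gen.
Qed.

End Nontrivial.

Local Notation quotI := {ideal_quot I}.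

Definition yokonuma : Type := quotI.
HB.instance Definition _ := GRing.Zmodule.on yokonuma.

Local Notation Y := yokonuma.

Definition yh_pi (x : yh_free) : Y := (\pi_(quotI) x)%qT.
Definition yh_repr (x : Y) : yh_free := repr (x : quotI).

Definition yh_one : Y := yh_pi 1.
Definition yh_mul : Y -> Y -> Y :=
  locked (fun x y => yh_pi (yh_repr x * yh_repr y)).
Definition yh_scale : L -> Y -> Y :=
  locked (fun c x => yh_pi (c *: yh_repr x)).

Lemma yh_reprK x : yh_pi (yh_repr x) = x.
Proof. exact: (@reprK _ quotI). Qed.

Lemma yh_pi_eq x y : (yh_pi x = yh_pi y) <-> (x - y \in I).
Proof.
have E : (x - y \in I) = (yh_pi x == yh_pi y) := Quotient.idealrBE I x y.
by rewrite E; split=> [->|/eqP].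
Qed.

Lemma yh_piB : {morph yh_pi : x y / x - y}.
Proof. by move=> x y; rewrite /yh_pi; exact: (raddfB (\pi_(quotI)%qT)). Qed.

Lemma yh_piD : {morph yh_pi : x y / x + y}.
Proof. by move=> x y; exact: (raddfD (\pi_(quotI)%qT)). Qed.

Lemma yh_piM : {morph yh_pi : x y / x * y >-> yh_mul x y}.
Proof.
move=> x y; rewrite /yh_mul -lock; apply/yh_pi_eq.
by apply: yh_idealBM; apply/yh_pi_eq; rewrite yh_reprK.
Qed.

Lemma yh_piZ c : {morph yh_pi : x / c *: x >-> yh_scale c x}.
Proof.
move=> x; rewrite /yh_scale -lock; apply/yh_pi_eq.
by apply: yh_idealBZ; apply/yh_pi_eq; rewrite yh_reprK.
Qed.

Local Fact yh_mulA : associative yh_mul.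
Proof.
by move=> x y z; rewrite -(yh_reprK x) -(yh_reprK y) -(yh_reprK z) -!yh_piM mulrA.
Qed.

Local Fact yh_mul1 : left_id yh_one yh_mul.
Proof. by move=> x; rewrite -(yh_reprK x) -yh_piM mul1r. Qed.

Local Fact yh_mulr1 : right_id yh_one yh_mul.
Proof. by move=> x; rewrite -(yh_reprK x) -yh_piM mulr1. Qed.

Local Fact yh_mulDl : left_distributive yh_mul +%R.
Proof.
move=> x y z; rewrite -(yh_reprK x) -(yh_reprK y) -(yh_reprK z).
by rewrite -yh_piD -!yh_piM -yh_piD mulrDl.
Qed.

Local Fact yh_mulDr : right_distributive yh_mul +%R.
Proof.
move=> x y z; rewrite -(yh_reprK x) -(yh_reprK y) -(yh_reprK z).
by rewrite -yh_piD -!yh_piM -yh_piD mulrDr.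
Qed.

Local Fact yh_one_neq0 : yh_one != 0.
Proof.
apply/eqP => h; case/negP: yh_ideal_proper; rewrite -[1]subr0.
by apply/yh_pi_eq; rewrite -/yh_one h -[in RHS](subrr 1) yh_piB subrr.
Qed.

HB.instance Definition _ := GRing.Zmodule_isNzRing.Build Y
  yh_mulA yh_mul1 yh_mulr1 yh_mulDl yh_mulDr yh_one_neq0.

Local Fact yh_scaleA a b x : yh_scale a (yh_scale b x) = yh_scale (a * b) x.
Proof. by rewrite -(yh_reprK x) -!yh_piZ scalerA. Qed.

Local Fact yh_scale1 : left_id 1 yh_scale.
Proof. by move=> x; rewrite -(yh_reprK x) -yh_piZ scale1r. Qed.

Local Fact yh_scaleDr : right_distributive yh_scale +%R.
Proof.
move=> a x y; rewrite -(yh_reprK x) -(yh_reprK y).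
by rewrite -yh_piD -!yh_piZ -yh_piD scalerDr.
Qed.

Local Fact yh_scaleDl x : {morph yh_scale^~ x : a b / a + b}.
Proof. by move=> a b; rewrite -(yh_reprK x) -!yh_piZ -yh_piD scalerDl. Qed.

HB.instance Definition _ := GRing.Zmodule_isLmodule.Build L Y
  yh_scaleA yh_scale1 yh_scaleDr yh_scaleDl.

Local Fact yh_scaleAl (c : L) (x y : Y) : c *: (x * y) = c *: x * y.
Proof.
rewrite -(yh_reprK x) -(yh_reprK y).
transitivity (yh_pi (c *: (yh_repr x * yh_repr y))); first by rewrite yh_piZ yh_piM.
by rewrite scalerAl yh_piM yh_piZ.
Qed.

HB.instance Definition _ := GRing.Lmodule_isLalgebra.Build L Y yh_scaleAl.

Local Fact yh_scaleAr (c : L) (x y : Y) : c *: (x * y) = x * (c *: y).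
Proof.
rewrite -(yh_reprK x) -(yh_reprK y).
transitivity (yh_pi (c *: (yh_repr x * yh_repr y))); first by rewrite yh_piZ yh_piM.
transitivity (yh_pi (yh_repr x * (c *: yh_repr y))); last by rewrite yh_piM yh_piZ.
by rewrite malg_scaleAr.
Qed.

HB.instance Definition _ := GRing.Lalgebra_isAlgebra.Build L Y yh_scaleAr.

Definition yh_g (i : 'I_n.-1) : Y := yh_pi (free_g i).
Definition yh_t (j : 'I_n) : Y := yh_pi (free_t j).

HB.instance Definition _ := GRing.isZmodMorphism.Build yh_free Y yh_pi yh_piB.
HB.instance Definition _ := GRing.isMonoidMorphism.Build yh_free Y yh_pi
  (erefl, yh_piM).
HB.instance Definition _ := GRing.isScalable.Build L yh_free Y *:%R yh_pi yh_piZ.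

Lemma yh_relations x : yh_relator q d yh_g yh_t x -> x = 0.
Proof.
have pi0 : yh_pi 0 = 0 by exact: raddf0.
case/(yh_relator_lift yh_piB yh_piM yh_piZ erefl) => y yR ->; rewrite -pi0.
by apply/yh_pi_eq; rewrite subr0; apply/asboolP; apply: Ideal_gen.
Qed.

Definition yh_gw (w : 'S_n) : Y := \prod_(i <- reduced_word w) yh_g i.
Definition yh_tmon (k : 'I_n -> nat) : Y := \prod_(j < n) yh_t j ^+ k j.

(* 'I_d serves as the set of representatives 0, ..., d - 1 of Z/dZ. *)
Definition yh_basis (kw : {ffun 'I_n -> 'I_d} * 'S_n) : Y :=
  yh_tmon (fun j => kw.1 j) * yh_gw kw.2.

Definition yh_tau : Y -> L :=
  lin_ext yh_basis
    (fun kw => if (kw.2 == 1%g) && [forall j, (d %| kw.1 j)%N] then 1 else 0).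

End YokonumaHecke.

Arguments yokonuma {L} q d n.
Arguments yh_gw {L} q d {n} w.
Arguments yh_tmon {L} q d {n} k.
Arguments yh_basis {L} q {d n} kw.
Arguments yh_tau {L} q {d n} x.

(* Main.v *)
From HB Require Import structures.
Require Import Defs.
From mathcomp Require Import all_boot all_fingroup all_algebra complex reals.
From mathcomp Require Import cyclic separable cyclotomic.
From mathcomp Require Import boolp monalg zify ring.

Set Implicit Arguments.
Unset Strict Implicit.
Unset Printing Implicit Defensive.

Import GRing.Theory Num.Theory.
Local Open Scope ring_scope.

(** The algebra is made to act on the functions of a character [x] of
    [(Z/d)^n] and a permutation [w], as if such a function were an element of
    the regular module written in the basis of the [e_x g_w], where [e_x] is
    the idempotent of the torus attached to [x].  There [t_j] is diagonal, with
    eigenvalue the [x_j]-th power of a primitive [d]-th root of unity [z], and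
    [g_i] sends [f] to
      [(x, w) |-> f (x s_i, s_i w) + c_i(x, w) f (x, w)],
    where [c_i(x, w)] is [q - q^-1] if [w] has a descent at [i] and
    [x_i = x_(i+1)], and [0] otherwise.  The idempotent [e_i] becomes the
    indicator of [x_i = x_(i+1)], so that every defining relation is a pointwise
    identity; the braid relation is a finite case analysis on the relative order
    of three values of [w] and on the coincidences between three values of [x].

    On this module the form is visible: [avg_tau a] applies [a] to the function
    [1] at [w = 1] and [0] elsewhere, and averages the result over the points
    [(x, 1)].  A reduced word never meets a descent ([reduced_no_descent], by the
    exchange condition), so along a reduced word the correction terms vanish, and
    [g_w] simply transports: from a function supported on [w = 1]
    ([g_act_support]), and also towards the points with [w = 1] ([g_act_at1]).
    Hence [avg_tau (t^k g_w t^l g_w' t^m)] is an average of a character of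
    [(Z/d)^n] if [w' = w^-1] and is [0] otherwise, and orthogonality of
    characters evaluates it ([avg_tauE]).

    This formula says that the proposed dual family pairs with the family [B] to
    the identity matrix, which makes [B] linearly independent.  It remains to
    see that [B] spans, and for that it is enough to exhibit any spanning family
    of the same size [d^n n!], since over a commutative ring a square matrix with
    a one-sided inverse is invertible ([basis_of_biorthogonal]).  The family used
    consists of the [t^k g_s] where [s] runs over the staircase words, which are
    concatenations of descending runs: the product of such a word by a
    generator is explicit, so that the span is visibly stable under right
    multiplication ([in_normal_form_span_g]).

    Once [B] is a basis, [avg_tau] agrees with [tau] on it, so it is [tau], and
    the symmetry of [tau] is read off from [avg_tauE] on the two dual bases. *)

(** * Bases from biorthogonal families *)

Lemma scalar_sum (R : comUnitRingType) (A : lmodType R) (f : A -> R) :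
    scalar f -> forall (I : finType) (c : I -> R) (v : I -> A),
  f (\sum_i c i *: v i) = \sum_i c i * f (v i).
Proof.
move=> fl I c v.
pose F : {linear A -> R^o} := HB.pack f (GRing.isLinear.Build _ _ _ _ f fl).
rewrite -[f]/(F : A -> R) linear_sum; apply: eq_bigr => i _.
by rewrite linearZ.
Qed.

(** Writing the [b i] in terms of the spanning family gives a square matrix [M],
    and biorthogonality gives it a right inverse [Q]; then [Q M = 1] too, which
    writes the spanning family in terms of the [b i]. *)
Lemma basis_of_biorthogonal (R : comUnitRingType) (A : lmodType R)
    (I J : finType) (b : I -> A) (e : J -> A) (psi : I -> A -> R) :
    #|J| = #|I| -> (forall i, scalar (psi i)) ->
    (forall a, exists c : J -> R, a = \sum_j c j *: e j) ->
    (forall i j, psi i (b j) = (i == j)%:R) ->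
  is_basis b.
Proof.
move=> cardJ psi_lin e_span psi_b.
have {e_span} [v v_span] : exists v : 'I_#|I| -> A,
    forall a, exists c : 'I_#|I| -> R, a = \sum_j c j *: v j.
  rewrite -cardJ; exists (e \o enum_val) => a; have [c ->] := e_span a.
  by exists (c \o enum_val); rewrite big_enum_val.
have [M bM] := choice (fun i => v_span (b i)).
pose Mx := \matrix_(i, j) M (enum_val i) j : 'M[R]_#|I|.
pose Q := \matrix_(j, i) psi (enum_val i) (v j) : 'M[R]_#|I|.
have /mulmx1C QM : Mx *m Q = 1%:M.
  apply/matrixP => i k; rewrite !mxE -(inj_eq enum_val_inj) eq_sym -psi_b bM.
  by rewrite scalar_sum //; apply: eq_bigr => j _; rewrite !mxE.
have vb k : v k = \sum_i psi i (v k) *: b i.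
  rewrite big_enum_val /=; under eq_bigr do rewrite bM scaler_sumr.
  rewrite exchange_big /= (bigD1 k) //= [X in _ + X]big1 ?addr0 => [|j jk].
    under eq_bigr do rewrite scalerA.
    rewrite -scaler_suml; have /matrixP/(_ k k) := QM.
    by rewrite !mxE eqxx; under eq_bigr do rewrite !mxE; move=> ->; rewrite scale1r.
  under eq_bigr do rewrite scalerA.
  rewrite -scaler_suml; have /matrixP/(_ k j) := QM.
  rewrite !mxE eq_sym (negPf jk); under eq_bigr do rewrite !mxE.
  by move=> ->; rewrite scale0r.
move=> a; have [c aE] := v_span a.
have bE : a = \sum_i [ffun i => psi i a] i *: b i.
  rewrite {1}aE; under eq_bigr do rewrite vb scaler_sumr.
  rewrite exchange_big /=; apply: eq_bigr => i _.
  rewrite ffunE aE scalar_sum // scaler_suml.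
  by apply: eq_bigr => j _; rewrite scalerA.
exists [ffun i => psi i a]; split => // c' c'E.
apply/ffunP => i; rewrite ffunE c'E scalar_sum // (bigD1 i) //= psi_b eqxx mulr1.
rewrite big1 ?addr0 // => j /negPf ji.
by rewrite psi_b eq_sym ji mulr0.
Qed.

(** * Reduced words and descents *)

Section Words.
Variable n : nat.
Implicit Types (s : seq 'I_n.-1) (w : 'S_n).

Lemma word_perm_nil : word_perm [::] = 1%g :> 'S_n.
Proof. exact: big_nil. Qed.

Lemma word_perm_cons (i : 'I_n.-1) s :
  word_perm (i :: s) = (adj_tperm i * word_perm s)%g.
Proof. exact: big_cons. Qed.

Lemma word_perm_cat s s' : word_perm (s ++ s') = (word_perm s * word_perm s')%g.
Proof. exact: big_cat. Qed.

Lemma adj_tpermK (i : 'I_n.-1) : (adj_tperm i * adj_tperm i)%g = 1%g.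
Proof. exact: tperm2. Qed.

Lemma word_perm_rev s : word_perm (rev s) = (word_perm s)^-1%g.
Proof.
elim: s => [|i s IH]; first by rewrite word_perm_nil invg1.
rewrite rev_cons -cats1 word_perm_cat IH !word_perm_cons word_perm_nil mulg1 invMg.
by rewrite tpermV.
Qed.

Definition reduced s := forall s', word_perm s' = word_perm s -> (size s <= size s')%N.

Lemma reduced_word_perm w : word_perm (reduced_word w) = w.
Proof. by rewrite /reduced_word; case: cid => s []. Qed.

Lemma reduced_reduced_word w : reduced (reduced_word w).
Proof.
by move=> s'; rewrite reduced_word_perm /reduced_word; case: cid => s [] /= _; apply.
Qed.

Lemma reduced_behead i s : reduced (i :: s) -> reduced s.
Proof.
move=> red s' s'E; have := red (i :: s'); rewrite !word_perm_cons s'E => /(_ erefl).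
by rewrite ltnS.
Qed.

Lemma reduced_rev s : reduced s -> reduced (rev s).
Proof.
move=> red s' s'E; rewrite size_rev -(size_rev s'); apply: red.
by rewrite word_perm_rev s'E word_perm_rev invgK.
Qed.

Lemma adj_left_lt (i : 'I_n.-1) : (adj_left i < adj_right i)%N.
Proof. exact: ltnSn. Qed.

(** Puts the values of a simple transposition in the reach of linear
    arithmetic. *)
Lemma val_adj_tperm (j : 'I_n.-1) (x : 'I_n) :
  adj_tperm j x = (if x == j :> nat then j.+1 else if x == j.+1 :> nat then j : nat else x)
    :> nat.
Proof.
rewrite /adj_tperm; case: tpermP => [->|->|xl xr] /=.
- by rewrite eqxx.
- by rewrite eqxx gtn_eqF.
have xl' : (x != j :> nat) by apply/eqP => xj; apply: xl; apply: val_inj.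
have xr' : (x != j.+1 :> nat) by apply/eqP => xj; apply: xr; apply: val_inj.
by rewrite (negPf xl') (negPf xr').
Qed.

Lemma adj_tperm_lt (j : 'I_n.-1) (a b : 'I_n) : (a < b)%N ->
  (adj_tperm j b < adj_tperm j a)%N -> a = adj_left j /\ b = adj_right j.
Proof.
rewrite !val_adj_tperm => ab h; split; apply: val_inj => /=; move: h; do !case: eqP; lia.
Qed.

(** The exchange condition: the images of [a] and [b] under the prefixes of the
    word start in increasing order and end in decreasing order, so some letter
    swaps them, and deleting that letter amounts to multiplying by
    [tperm a b]. *)
Lemma word_perm_exchange s (a b : 'I_n) : (a < b)%N ->
    (word_perm s b < word_perm s a)%N ->
  exists s', (size s').+1 = size s /\ (tperm a b * word_perm s = word_perm s')%g.
Proof.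
elim: s a b => [|j s IH] a b ab; first by rewrite word_perm_nil !perm1 ltnNge ltnW.
rewrite word_perm_cons !permM => lt_ba.
have [ba'|ab'|/val_inj/perm_inj ab'] := ltngtP (adj_tperm j b) (adj_tperm j a).
- have [-> ->] := adj_tperm_lt ab ba'.
  by exists s; rewrite mulgA adj_tpermK mul1g.
- have [s' [s's s'E]] := IH _ _ ab' lt_ba.
  exists (j :: s'); split; rewrite /= ?s's // word_perm_cons -s'E !mulgA.
  by rewrite [(tperm a b * _)%g]conjgC tpermJ.
- by move: ab; rewrite ab' ltnn.
Qed.

(** A descent would let the exchange condition delete a letter of [s], giving a
    word for the permutation of [i :: s] shorter by two letters. *)
Lemma reduced_no_descent i s : reduced (i :: s) ->
  (word_perm s (adj_left i) < word_perm s (adj_right i))%N.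
Proof.
move=> red; rewrite ltnNge leq_eqVlt; apply/negP => /orP[/eqP/val_inj/perm_inj E|].
  by have := adj_left_lt i; rewrite E ltnn.
move=> /(word_perm_exchange (adj_left_lt i)) [s' [s's s'E]].
by have := red s'; rewrite word_perm_cons -s'E => /(_ erefl); rewrite /= -s's ltnNge leqnSn.
Qed.

End Words.

(** * The action of the free algebra *)

Lemma dvdn_add_subr d (a b : 'I_d) : (d %| a + (d - b))%N = (a == b).
Proof.
apply/idP/eqP => [|->]; last by rewrite subnKC // ltnW.
case/dvdnP => k kE; apply: val_inj => /=; have := ltn_ord a; have := ltn_ord b.
by move: kE; case: k => [|[|k]]; rewrite ?mulSn; nia.
Qed.

Section Action.
Variables (L : comUnitRingType) (q : L) (d n : nat) (z : L).
Hypothesis d_unit : d%:R \is a @GRing.unit L.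
Hypothesis z_order : z ^+ d = 1.
Hypothesis z_sum : forall m, \sum_(a < d) z ^+ (a * m) = d%:R *+ (d %| m).

Local Notation yh_gen := ('I_n.-1 + 'I_n)%type.
Local Notation yh_free := {malg L[{fmonom yh_gen}]}.
Local Notation point := ({ffun 'I_n -> 'I_d} * 'S_n)%type.
Local Notation free_g := (free_g L).
Local Notation free_t := (free_t L).

(** The second component is a coordinate on the regular module of the symmetric
    group and the first one a character of the torus; [s] acts on both from the
    left. *)
Definition shift (s : 'S_n) (p : point) : point := ([ffun j => p.1 (s j)], s * p.2)%g.

Lemma shift1 p : shift 1%g p = p.
Proof.
case: p => x w; rewrite /shift mul1g; congr pair.
by apply/ffunP => j; rewrite ffunE perm1.
Qed.

Lemma shiftM s s' p : shift (s * s')%g p = shift s (shift s' p).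
Proof.
rewrite /shift /= mulgA; congr pair.
by apply/ffunP => j; rewrite !ffunE permM.
Qed.

Definition descent_coef (a b : 'I_n) (p : point) : L :=
  (q - q^-1) *+ ((p.2 b < p.2 a)%N && (p.1 a == p.1 b)).

Lemma descent_coef_shift a b s p :
  descent_coef a b (shift s p) = descent_coef (s a) (s b) p.
Proof. by rewrite /descent_coef /= !permM !ffunE. Qed.

Definition gen_act (x : yh_gen) (f : point -> L) (p : point) : L :=
  match x with
  | inl i => f (shift (adj_tperm i) p)
             + descent_coef (adj_left i) (adj_right i) p * f p
  | inr j => z ^+ p.1 j * f p
  end.

Definition word_act (m : seq yh_gen) (f : point -> L) : point -> L := foldr gen_act f m.

Lemma gen_act_sum x (J : Type) (r : seq J) (c : J -> L) (F : J -> point -> L) p :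
  gen_act x (fun p => \sum_(j <- r) c j * F j p) p = \sum_(j <- r) c j * gen_act x (F j) p.
Proof.
case: x => [i|j] /=; rewrite mulr_sumr -?big_split /=; apply: eq_bigr => k _.
  by rewrite mulrDr; congr (_ + _); rewrite mulrCA.
by rewrite mulrCA.
Qed.

Lemma word_act_sum m (J : Type) (r : seq J) (c : J -> L) (F : J -> point -> L) p :
  word_act m (fun p => \sum_(j <- r) c j * F j p) p
    = \sum_(j <- r) c j * word_act m (F j) p.
Proof.
elim: m p => [//|x m IH] p /=; rewrite -gen_act_sum; congr gen_act.
exact/funext.
Qed.

Definition free_act (x : yh_free) (f : point -> L) (p : point) : L :=
  mmap idfun (fun m : {fmonom yh_gen} => word_act m f p) x.

Lemma free_actB x y f p : free_act (x - y) f p = free_act x f p - free_act y f p.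
Proof. exact: raddfB. Qed.

Lemma free_actD x y f p : free_act (x + y) f p = free_act x f p + free_act y f p.
Proof. exact: raddfD. Qed.

Lemma free_act_sum (J : Type) (r : seq J) (F : J -> yh_free) f p :
  free_act (\sum_(j <- r) F j) f p = \sum_(j <- r) free_act (F j) f p.
Proof. exact: raddf_sum. Qed.

Lemma free_act1 f : free_act 1 f = f.
Proof.
by apply/funext => p; rewrite -mpolyC1E /free_act /malgC mmapU mul1r fm1.
Qed.

Lemma free_actM x y f : free_act (x * y) f = free_act x (free_act y f).
Proof.
apply/funext => p; rewrite malgM_def free_act_sum [RHS]mmapE /=.
apply: eq_bigr => k _; rewrite free_act_sum /free_act.
under [in RHS]eq_fun do rewrite mmapE.
rewrite word_act_sum mulr_sumr; apply: eq_bigr => l _.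
by rewrite mmapU /= fmM /word_act foldr_cat mulrA.
Qed.

Lemma free_actZ c x f p : free_act (c *: x) f p = c * free_act x f p.
Proof.
by rewrite -mul_malgC free_actM {1}/free_act /malgC mmapU /= fm1.
Qed.

Lemma free_act_gen x f : free_act (malg_gen L x) f = gen_act x f.
Proof. by apply/funext => p; rewrite /free_act malg_gen.unlock mmapU mul1r fmU. Qed.

Lemma free_act_g i f : free_act (@free_g n i) f = gen_act (inl i) f.
Proof. exact: free_act_gen. Qed.

Lemma free_act_t j f : free_act (@free_t n j) f = gen_act (inr j) f.
Proof. exact: free_act_gen. Qed.

Lemma free_act_zero x p : free_act x (fun=> 0) p = 0.
Proof.
rewrite /free_act mmapE big1 // => m _.
suff -> : word_act m (fun=> 0) p = 0 by rewrite mulr0.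
elim: (m : seq _) p => [//|[i|j] r IH] p /=; rewrite ?IH ?mulr0 ?addr0 //.
Qed.

(** Both sides are combinations of the values of [f] at the same six points.  The
    coefficients only depend on the order of [p.2 a], [p.2 b], [p.2 c] and on
    which of [p.1 a], [p.1 b], [p.1 c] are equal. *)
Lemma gen_act_braid (i j : 'I_n.-1) f : j = i.+1 :> nat ->
  gen_act (inl i) (gen_act (inl j) (gen_act (inl i) f))
    = gen_act (inl j) (gen_act (inl i) (gen_act (inl j) f)).
Proof.
move=> ij; apply/funext => p.
pose a := adj_left i; pose b := adj_right i; pose c := adj_right j.
have bE : adj_left j = b by apply: val_inj.
have ab : a != b by rewrite -val_eqE /= neq_ltn ltnSn.
have bc : b != c by rewrite -val_eqE /= ij neq_ltn ltnSn.
have ac : a != c by rewrite -val_eqE /= ij; lia.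
have braid : (tperm a b * tperm b c * tperm a b = tperm b c * tperm a b * tperm b c)%g.
  rewrite -!mulgA -[X in (X * _)%g = _]tpermV -[X in _ = (X * _)%g]tpermV.
  rewrite -!conjgE !tpermJ tpermR tpermL ![tperm _ _ _]tpermD // 1?eq_sym //.
rewrite /= -!shiftM !descent_coef_shift /adj_tperm bE -/a -/b -/c.
have iE : (tperm a b a = b) * (tperm a b b = a) * (tperm a b c = c).
  by rewrite tpermL tpermR tpermD.
have jE : (tperm b c a = a) * (tperm b c b = c) * (tperm b c c = b).
  by rewrite tpermL tpermR tpermD // eq_sym.
rewrite !permM !(iE, jE) !tperm2 !shift1 !mulgA braid /descent_coef.
have inj := inj_eq (@perm_inj _ p.2).
have neq x y : x != y -> (p.2 x : nat) != p.2 y by rewrite val_eqE inj.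
move/neq: bc; move/neq: ac; move/neq: ab.
case: (ltngtP (p.2 a) (p.2 b)) => // lab _;
case: (ltngtP (p.2 a) (p.2 c)) => // lac _;
case: (ltngtP (p.2 b) (p.2 c)) => // lbc _; try lia;
rewrite /= ?(eq_sym (p.1 c)) ?(eq_sym (p.1 b) (p.1 a)) ?mulr0n ?mul0r ?mulr0 ?addr0;
  case: (p.1 a =P p.1 b) => e1; case: (p.1 b =P p.1 c) => e2;
  case: (p.1 a =P p.1 c) => e3; rewrite ?mulr0n ?mulr1n; first [congruence | ring].
Qed.

(** Exactly one of [w] and [s_i w] has a descent at [i], so the two correction
    coefficients met along [g_i g_i] add up to the coefficient of [e_i]. *)
Lemma gen_act_quadratic i f p :
  gen_act (inl i) (gen_act (inl i) f) p
    = f p + (q - q^-1) * (gen_act (inl i) f p *+ (p.1 (adj_left i) == p.1 (adj_right i))).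
Proof.
rewrite /= -shiftM adj_tpermK shift1 descent_coef_shift /adj_tperm tpermL tpermR.
set a := adj_left i; set b := adj_right i; rewrite /descent_coef (eq_sym (p.1 b)).
have : (p.2 a : nat) != p.2 b.
  by rewrite val_eqE (inj_eq perm_inj) -val_eqE neq_ltn ltnSn.
by case: ltngtP => // _ _; case: eqP => _; rewrite /= ?mulr0n ?mulr1n; ring.
Qed.

(** A nonzero coefficient forces the character to take the same value at [a]
    and [b]; hence the correction term, which [g_i] does not move, still
    satisfies [t_j g_i = g_i t_(s_i(j))]. *)
Lemma descent_coef_tperm a b p j :
  descent_coef a b p * z ^+ p.1 (tperm a b j) = descent_coef a b p * z ^+ p.1 j.
Proof.
rewrite /descent_coef; case: (p.1 a =P p.1 b) => [E|_]; last by rewrite andbF !mul0r.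
by case: tpermP => [->|->|//]; rewrite E.
Qed.

(** Only the compatibility of the action with the algebra operations matters
    here, so the algebra is arbitrary. *)
Section IdealActsByZero.
Variables (A : lalgType L) (g : 'I_n.-1 -> A) (t : 'I_n -> A).
Variable act : A -> (point -> L) -> point -> L.
Hypothesis actB : forall x y f p, act (x - y) f p = act x f p - act y f p.
Hypothesis actM : forall x y f, act (x * y) f = act x (act y f).
Hypothesis actZ : forall c x f p, act (c *: x) f p = c * act x f p.
Hypothesis act1 : forall f, act 1 f = f.
Hypothesis act_zero : forall x p, act x (fun=> 0) p = 0.
Hypothesis act_g : forall i f, act (g i) f = gen_act (inl i) f.
Hypothesis act_t : forall j f, act (t j) f = gen_act (inr j) f.

Let act0 f p : act 0 f p = 0.
Proof. by have := actB 0 0 f p; rewrite subr0 subrr. Qed.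

Let actD x y f p : act (x + y) f p = act x f p + act y f p.
Proof. by rewrite -{1}[y]opprK actB -[- y]sub0r actB act0 sub0r opprK. Qed.

Lemma act_tX j k f p : act (t j ^+ k) f p = z ^+ (p.1 j * k) * f p.
Proof.
elim: k p => [|k IH] p; first by rewrite expr0 act1 muln0 expr0 mul1r.
by rewrite exprS actM act_t /= IH mulnS exprD mulrA.
Qed.

(** By orthogonality of the characters of [Z/d], the average defining [e_i] is
    the indicator of the points where the characters of [t_i] and [t_(i+1)]
    coincide. *)
Lemma act_idem i f p :
  act (yh_idem d t i) f p = f p *+ (p.1 (adj_left i) == p.1 (adj_right i)).
Proof.
rewrite /yh_idem actZ (big_morph (fun x => act x f p) (fun x y => actD x y f p) (act0 f p)).
set a := p.1 _; set b := p.1 _.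
transitivity (d%:R^-1 * (\sum_(s < d) z ^+ (s * (a + (d - b)))) * f p).
  rewrite -mulrA mulr_suml; congr (_ * _); apply: eq_bigr => s _.
  rewrite actM !act_tX mulrA -exprD.
  congr (_ * _); rewrite -/a -/b.
  have -> : (s * (a + (d - b)) = a * s + (d - b) * s)%N by rewrite mulnC mulnDl.
  (* Both exponents [b * (d - s)] and [(d - b) * s] are completed to multiples
     of [d] by adding [(d - b) * (d - s)]. *)
  have h1 : (d * (d - s) = (d - b) * (d - s) + b * (d - s))%N.
    by rewrite -mulnDl subnK // ltnW.
  have h2 : (d * (d - b) = (d - b) * s + (d - b) * (d - s))%N.
    by have sd := ltnW (ltn_ord s); rewrite -mulnDr subnKC // mulnC.
  rewrite !exprD; congr (_ * _).
  have zd m : z ^+ (d * m) = 1 by rewrite exprM z_order expr1n.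
  have := zd (d - s)%N; have := zd (d - b)%N; rewrite h1 h2 !exprD => e2 e1.
  by rewrite -[LHS]mul1r -e2 -mulrA e1 mulr1.
rewrite z_sum mulrnAr mulVr //.
by rewrite dvdn_add_subr; case: (a == b); rewrite ?mul1r ?mul0r.
Qed.

Lemma act_ideal x : x \in yh_ideal q d g t ->
  forall f p, act x f p = 0.
Proof.
have ext u v f : act u f = act v f -> forall p, act (u - v) f p = 0.
  by move=> uv p; rewrite actB uv subrr.
move=> /asboolP; elim=> {x} [_ []||x y _ IHx _ IHy|a x _ IH|a x _ IH].
- move=> i j ij f; apply: ext; rewrite !actM ?act_g ?act_t; apply/funext => p /=.
  rewrite -!shiftM !descent_coef_shift.
  have disj x y : x \in [:: adj_left i; adj_right i] ->
      y \in [:: adj_left j; adj_right j] -> x != y.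
    by move=> xi yj; apply/eqP => E; move: ij xi yj; rewrite E !inE -!val_eqE /=; lia.
  have fixj x : x \in [:: adj_left i; adj_right i] -> adj_tperm j x = x.
    by move=> xi; rewrite /adj_tperm tpermD // eq_sym disj // !inE eqxx ?orbT.
  have fixi y : y \in [:: adj_left j; adj_right j] -> adj_tperm i y = y.
    by move=> yj; rewrite /adj_tperm tpermD // disj // !inE eqxx ?orbT.
  have C : (adj_tperm i * adj_tperm j = adj_tperm j * adj_tperm i)%g.
    by rewrite conjgC [X in (_ * X)%g]tpermJ !fixj // !inE eqxx ?orbT.
  by rewrite -C !fixi ?fixj ?inE ?eqxx ?orbT //; ring.
- by move=> i j ij f; apply: ext; rewrite !actM !act_g; apply: gen_act_braid.
- move=> i j f; apply: ext; rewrite !actM ?act_g ?act_t; apply/funext => p /=.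
  by rewrite mulrCA.
- move=> j i f; apply: ext; rewrite !actM ?act_g ?act_t; apply/funext => p /=.
  rewrite ffunE /adj_tperm tpermK mulrDr; congr (_ + _).
  by rewrite mulrA [RHS]mulrA descent_coef_tperm; congr (_ * _); rewrite mulrC.
- move=> j f; apply: ext; apply/funext => p.
  by rewrite act_tX act1 mulnC exprM z_order expr1n mul1r.
- move=> i f; apply: ext; apply/funext => p.
  rewrite actD act1 actZ actM act_idem expr2 actM !act_g.
  exact: gen_act_quadratic.
- exact: act0.
- by move=> f p; rewrite actB IHx IHy subrr.
- move=> f p; rewrite actM -[RHS](act_zero a p); congr act.
  exact/funext/IH.
- by move=> f p; rewrite actM IH.
Qed.

End IdealActsByZero.

Lemma free_act_ideal x : x \in yh_ideal q d (@free_g n) (@free_t n) ->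
  forall f p, free_act x f p = 0.
Proof.
apply: act_ideal.
- exact: free_actB.
- exact: free_actM.
- exact: free_actZ.
- exact: free_act1.
- exact: free_act_zero.
- exact: free_act_g.
- exact: free_act_t.
Qed.

End Action.

(** * The averaged form *)

Section Form.
Variables (L : comUnitRingType) (q : L) (d n : nat) (z : L).
Hypothesis d_unit : d%:R \is a @GRing.unit L.
Hypothesis z_order : z ^+ d = 1.
Hypothesis z_sum : forall m, \sum_(a < d) z ^+ (a * m) = d%:R *+ (d %| m).

Local Notation point := ({ffun 'I_n -> 'I_d} * 'S_n)%type.
Local Notation Y := (yokonuma q d n).
Local Notation gen_act := (gen_act q z).
Local Notation free_act := (free_act q z).

Definition yh_act (a : Y) (f : point -> L) : point -> L := free_act (yh_repr a) f.

Lemma yh_act_pi x f : yh_act (yh_pi q d x) f = free_act x f.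
Proof.
apply/funext => p; apply/eqP; rewrite -subr_eq0 -free_actB; apply/eqP.
by apply: free_act_ideal => //; apply/yh_pi_eq; rewrite yh_reprK.
Qed.

Lemma yh_actD (a b : Y) f p : yh_act (a + b) f p = yh_act a f p + yh_act b f p.
Proof. by rewrite -[a]yh_reprK -[b]yh_reprK -yh_piD !yh_act_pi free_actD. Qed.

Lemma yh_actZ c (a : Y) f p : yh_act (c *: a) f p = c * yh_act a f p.
Proof.
by rewrite -[a]yh_reprK -[c *: _](yh_piZ q d c (yh_repr a)) !yh_act_pi free_actZ.
Qed.

Lemma yh_act1 f : yh_act 1 f = f.
Proof. by rewrite -[1]/(yh_pi q d 1) yh_act_pi free_act1. Qed.

Lemma yh_actM (a b : Y) f : yh_act (a * b) f = yh_act a (yh_act b f).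
Proof.
rewrite -[a]yh_reprK -[b]yh_reprK -[_ * _](yh_piM q d (yh_repr a) (yh_repr b)).
by rewrite !yh_act_pi free_actM.
Qed.

Lemma yh_act_g i f : yh_act (yh_g q d i) f = gen_act (inl i) f.
Proof. by rewrite yh_act_pi free_act_g. Qed.

Lemma yh_act_t j f : yh_act (yh_t q d j) f = gen_act (inr j) f.
Proof. by rewrite yh_act_pi free_act_t. Qed.

Lemma yh_act_tX j k f p : yh_act (yh_t q d j ^+ k) f p = z ^+ (p.1 j * k) * f p.
Proof. exact: (act_tX yh_actM yh_act1 yh_act_t). Qed.

Lemma yh_act_tmon k f p :
  yh_act (yh_tmon q d k) f p = z ^+ (\sum_j p.1 j * k j) * f p.
Proof.
rewrite /yh_tmon; elim: (index_enum _) p => [|j r IH] p.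
  by rewrite !big_nil yh_act1 expr0 mul1r.
by rewrite !big_cons yh_actM yh_act_tX IH mulrA exprD.
Qed.

Definition g_act (s : seq 'I_n.-1) (f : point -> L) : point -> L :=
  foldr (fun i => gen_act (inl i)) f s.

Lemma yh_act_gw w f : yh_act (yh_gw q d w) f = g_act (reduced_word w) f.
Proof.
rewrite /yh_gw; elim: (reduced_word w) => [|i s IH]; first by rewrite big_nil yh_act1.
by rewrite big_cons yh_actM yh_act_g IH.
Qed.

(** The correction term of the first letter [i] is evaluated at the permutation
    of the rest of the word, which has no descent at [i]. *)
Lemma g_act_support s f p : reduced s -> (forall p, p.2 != 1%g -> f p = 0) ->
  g_act s f p = f (shift (word_perm s)^-1 p) *+ (p.2 == word_perm s).
Proof.
move=> + f0; elim: s p => [|i s IH] p red /=.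
  by rewrite word_perm_nil invg1 shift1; case: eqP => [//|/eqP/f0 ->].
have IH' := IH _ (reduced_behead red).
rewrite !IH' word_perm_cons invMg shiftM tpermV.
rewrite -(inj_eq (mulgI (adj_tperm i)) (shift _ p).2) /= mulgA adj_tpermK mul1g.
rewrite -[RHS]addr0; congr (_ + _); case: eqP => [E|_]; last by rewrite mulr0n mulr0.
by rewrite /descent_coef E ltnNge ltnW ?reduced_no_descent // mul0r.
Qed.

(** Here the corrections are met from the left: after the letters before [i],
    the point has moved to the inverse of their permutation, i.e. to the
    permutation of the reversed word, which is reduced as well. *)
Lemma g_act_at1 s f p : reduced s -> p.2 = 1%g ->
  g_act s f p = f (shift (word_perm s)^-1 p).
Proof.
move=> + p1; elim/last_ind: s f => [|s i IH] f red; first by rewrite /= word_perm_nil invg1 shift1.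
have redr : reduced (i :: rev s) by rewrite -rev_rcons; apply: reduced_rev.
rewrite /g_act foldr_rcons -/(g_act _ _) IH; last first.
  by rewrite -[s]revK; apply/reduced_rev/(reduced_behead redr).
rewrite /= -shiftM -cats1 word_perm_cat word_perm_cons word_perm_nil mulg1 invMg tpermV.
rewrite -[RHS]addr0; congr (_ + _).
by rewrite /descent_coef /= p1 mulg1 -word_perm_rev ltnNge ltnW ?reduced_no_descent // mul0r.
Qed.

Definition delta1 (p : point) : L := (p.2 == 1%g)%:R.

Definition avg_tau (a : Y) : L :=
  (d%:R ^+ n)^-1 * \sum_(x : {ffun 'I_n -> 'I_d}) yh_act a delta1 (x, 1%g).

Lemma avg_tau_scalar : scalar avg_tau.
Proof.
move=> c a b; rewrite /avg_tau mulrCA -mulrDr; congr (_ * _).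
rewrite mulr_sumr -big_split; apply: eq_bigr => x _.
by rewrite yh_actD yh_actZ.
Qed.

(** Orthogonality of characters of [(Z/d)^n], one coordinate at a time. *)
Lemma character_sum (e : 'I_n -> nat) :
  \sum_(x : {ffun 'I_n -> 'I_d}) z ^+ (\sum_j x j * e j)
    = d%:R ^+ n *+ [forall j, d %| e j]%N.
Proof.
under eq_bigr do rewrite expr_sum.
rewrite -(bigA_distr_bigA (fun j (a : 'I_d) => z ^+ (a * e j))).
under eq_bigr do rewrite z_sum.
case: forallP => [de|nde].
  by under eq_bigr do rewrite de; rewrite prodr_const card_ord.
have /existsP[j /negPf dj] : [exists j, ~~ (d %| e j)%N].
  by rewrite -negb_forall; apply/forallP.
by rewrite (bigD1 j) //= dj mul0r.
Qed.

(** The torus elements contribute the exponents [k j], [l (w j)] and [m j]: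
    the middle one has been carried through [g_w].  All three are kept because
    the products of a basis element with a dual one, in the two orders, need
    [k] and [m] in one case and [l] in the other. *)
Lemma avg_tauE (k l m : 'I_n -> nat) (w w' : 'S_n) :
  avg_tau (yh_tmon q d k * yh_gw q d w * yh_tmon q d l * yh_gw q d w' * yh_tmon q d m)
    = ((w^-1%g == w') && [forall j, d %| k j + l (w j) + m j]%N)%:R.
Proof.
transitivity ((d%:R ^+ n)^-1 * \sum_(x : {ffun 'I_n -> 'I_d})
    z ^+ (\sum_j x j * (k j + l (w j) + m j)) *+ (w^-1%g == w')); last first.
  rewrite sumrMnl character_sum; case: (_ == _); case: [forall j, _];
    by rewrite ?mulr0n ?mulr0 // !mulr1n mulVr // unitrX.
congr (_ * _); apply: eq_bigr => x _.
rewrite !yh_actM yh_act_tmon yh_act_gw g_act_at1 //; last exact: reduced_reduced_word.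
rewrite yh_act_tmon yh_act_gw g_act_support; last 2 first.
- exact: reduced_reduced_word.
- by move=> p /negPf p1; rewrite yh_act_tmon /delta1 p1 mulr0.
rewrite !reduced_word_perm yh_act_tmon /delta1 /= !mulg1.
case: (w^-1%g =P w') => [<-|_]; last by rewrite !mulr0n !mulr0.
rewrite !mulr1n invgK mulgV eqxx mulr1 -!exprD; congr (z ^+ _).
rewrite [X in (_ + (X + _))%N](reindex_inj (@perm_inj _ w)) -!big_split.
by apply: eq_bigr => j _; rewrite !ffunE permK !mulnDr /= addnA.
Qed.

End Form.

(** * Staircase normal forms *)

Inductive in_span (L : comUnitRingType) (A : lmodType L) (P : A -> Prop) : A -> Prop :=
| Span_gen x : P x -> in_span P x
| Span_0 : in_span P 0
| Span_D x y : in_span P x -> in_span P y -> in_span P (x + y)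
| Span_Z c x : in_span P x -> in_span P (c *: x).

Lemma span_sum (L : comUnitRingType) (A : lmodType L) (P : A -> Prop)
    (J : Type) (r : seq J) (X : J -> A) :
  (forall j, in_span P (X j)) -> in_span P (\sum_(j <- r) X j).
Proof.
move=> PX; elim: r => [|j r IH]; first by rewrite big_nil; apply: Span_0.
by rewrite big_cons; apply: Span_D.
Qed.

Lemma span_mulr (L : comUnitRingType) (A : algType L) (P Q : A -> Prop) (b : A) :
    (forall x, P x -> in_span Q (x * b)) ->
  forall a, in_span P a -> in_span Q (a * b).
Proof.
move=> PQ a; elim=> [x /PQ //||x y _ IHx _ IHy|c x _ IH].
- by rewrite mul0r; apply: Span_0.
- by rewrite mulrDl; apply: Span_D.
- by rewrite -scalerAl; apply: Span_Z.
Qed.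

Lemma span_family (L : comUnitRingType) (A : lmodType L) (P : A -> Prop)
    (J : finType) (X : J -> A) :
    (forall x, P x -> exists j, x = X j) ->
  forall a, in_span P a -> exists c : J -> L, a = \sum_j c j *: X j.
Proof.
move=> PX a; elim=> [x /PX [j ->]||x y _ [c ->] _ [c' ->]|k x _ [c ->]].
- exists (fun i => (i == j)%:R); rewrite (bigD1 j) //= eqxx scale1r big1 ?addr0 //.
  by move=> i /negPf ->; rewrite scale0r.
- by exists (fun=> 0); rewrite big1 // => i _; rewrite scale0r.
- exists (fun i => c i + c' i); rewrite -big_split; apply: eq_bigr => i _.
  by rewrite scalerDl.
- by exists (fun i => k * c i); rewrite scaler_sumr; apply: eq_bigr => i _; rewrite scalerA.
Qed.

Definition descending (m j : nat) : seq nat := [seq m - k | k <- iota 0 j]%N.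

(** Words for the permutations of [0, ..., m]: a coset representative of the
    permutations fixing [m] is a descending run from [m - 1]. *)
Fixpoint staircase (m : nat) : seq (seq nat) :=
  if m is m'.+1 then [seq s ++ descending m' j | s <- staircase m', j <- iota 0 m'.+2]
  else [:: [::]].

Lemma size_staircase m : size (staircase m) = m.+1`!.
Proof.
elim: m => [//|m IH].
transitivity (size (staircase m) * size (iota 0 m.+2))%N; first exact: size_allpairs.
by rewrite IH size_iota mulnC.
Qed.

Lemma nil_in_staircase m : [::] \in staircase m.
Proof.
by elim: m => [//|m IH]; apply/allpairsPdep; exists [::], 0%N; split.
Qed.

Section NormalForms.
Variables (L : comUnitRingType) (q : L) (d n : nat) (A : algType L).
Variables (g : 'I_n.-1 -> A) (t : 'I_n -> A).
Hypothesis rel0 : forall x, yh_relator q d g t x -> x = 0.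

(* Letters are indexed by [nat], with [0] out of range, so that runs can be
   handled by arithmetic on indices. *)
Let gn (i : nat) : A := oapp g 0 (insub i).

Let gnE (i : 'I_n.-1) : gn i = g i.
Proof. by rewrite /gn valK. Qed.

Variant gn_spec (i : nat) : bool -> A -> Type :=
| Gn_in (i' : 'I_n.-1) of i = i' : gn_spec i true (g i')
| Gn_out : gn_spec i false 0.

Let gnP i : gn_spec i (i < n.-1)%N (gn i).
Proof. by rewrite /gn; case: insubP => [i' -> <-|/negPf ->]; constructor. Qed.

Let gn_comm i j : (i.+1 < j)%N -> gn i * gn j = gn j * gn i.
Proof.
case: gnP => [i' ->|] ij; last by rewrite mul0r mulr0.
case: gnP ij => [j' ->|] ij; last by rewrite mul0r mulr0.
by apply/subr0_eq/rel0/Rel_comm_g; rewrite ij.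
Qed.

Let gn_braid i : (i.+1 < n.-1)%N -> gn i * gn i.+1 * gn i = gn i.+1 * gn i * gn i.+1.
Proof.
move=> hi; have := ltnW hi; case: gnP => // i' iE _.
case: gnP hi => // j' jE _; apply/subr0_eq/rel0/Rel_braid.
by rewrite -jE iE.
Qed.

Let tX_g i j k : t j ^+ k * g i = g i * t (adj_tperm i j) ^+ k.
Proof.
elim: k => [|k IH]; first by rewrite !expr0 mulr1 mul1r.
rewrite exprSr -mulrA (subr0_eq (rel0 (Rel_tg q d g t j i))) mulrA IH -mulrA.
by rewrite -exprSr.
Qed.

Let gn_t i j : exists j', gn i * t j = t j' * gn i.
Proof.
case: gnP => [i' _|]; last by exists j; rewrite mul0r mulr0.
by exists (adj_tperm i' j); have := tX_g i' (adj_tperm i' j) 1; rewrite !expr1 /adj_tperm tpermK.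
Qed.

(* [e_i] is moved to the right of [g_i], which only permutes its [t]s: stability
   under right multiplication by the torus then disposes of it. *)
Let gn_sqr i : (i < n.-1)%N -> exists u (a b : 'I_n),
  gn i * gn i = 1 + u *: \sum_(s < d) gn i * (t a ^+ s * t b ^+ (d - s)).
Proof.
case: gnP => // i' _ _.
have swap s : t (adj_left i') ^+ s * t (adj_right i') ^+ (d - s) * g i'
    = g i' * (t (adj_right i') ^+ s * t (adj_left i') ^+ (d - s)).
  by rewrite -mulrA tX_g mulrA tX_g /adj_tperm tpermL tpermR mulrA.
exists ((q - q^-1) * d%:R^-1), (adj_right i'), (adj_left i').
rewrite -expr2 (subr0_eq (rel0 (Rel_quadratic q d g t i'))) -scalerA; congr (_ + _ *: _).
rewrite -scalerAl; congr (_ *: _); rewrite mulr_suml; apply: eq_bigr => s _.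
exact: swap.
Qed.

Definition torus (k : 'I_n -> nat) : A := \prod_j t j ^+ k j.

Let t_comm i j : t i * t j = t j * t i.
Proof. exact/subr0_eq/rel0/Rel_comm_t. Qed.

Lemma torusM k l : torus k * torus l = torus (fun j => k j + l j)%N.
Proof.
rewrite /torus -prodrM_comm => [|a b _ _].
  by apply: eq_bigr => i _; rewrite exprD.
by apply: commrX; apply/commr_sym/commrX/t_comm.
Qed.

Let torus_t k j : torus k * t j = torus (fun i => k i + (i == j))%N.
Proof.
rewrite -torusM; congr (_ * _); rewrite /torus.
rewrite (eq_bigr (fun i => if i == j then t i else 1)) => [|i _]; last by case: eqP.
by rewrite -big_mkcond big_pred1_eq.
Qed.

Let torus_mod k : torus k = torus (fun j => k j %% d)%N.
Proof.
apply: eq_bigr => j _; rewrite expr_mod //.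
exact/subr0_eq/rel0/Rel_order.
Qed.

Let gword (s : seq nat) : A := \prod_(i <- s) gn i.

Let gword_cat s s' : gword (s ++ s') = gword s * gword s'.
Proof. exact: big_cat. Qed.

Let gword_t s j : exists j', gword s * t j = t j' * gword s.
Proof.
elim: s j => [|i s IH] j; first by exists j; rewrite /gword big_nil mulr1 mul1r.
rewrite /gword big_cons; have [j1 E1] := IH j; have [j2 E2] := gn_t i j1.
by exists j2; rewrite -mulrA E1 mulrA E2 mulrA.
Qed.

Let D m j := gword (descending m j).

Let D0 m : D m 0 = 1.
Proof. exact: big_nil. Qed.

Let DS m j : D m j.+1 = D m j * gn (m - j).
Proof.
by rewrite /D /descending -addn1 iotaD map_cat gword_cat /gword /= big_seq1.
Qed.

Let D_comm m j i : (i + j < m)%N -> D m j * gn i = gn i * D m j.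
Proof.
elim: j => [|j IH] ijm; first by rewrite D0 mul1r mulr1.
rewrite DS -mulrA -gn_comm; last by lia.
by rewrite !mulrA IH //; lia.
Qed.

(* The run contains [g_i g_(i-1)]; the letters after it commute with [g_i], the
   braid relation turns [g_i g_(i-1) g_i] into [g_(i-1) g_i g_(i-1)], and the
   new [g_(i-1)] commutes with the letters before. *)
Let D_braid m j i : (m < n.-1)%N -> (i <= m)%N -> (j <= m.+1)%N -> (m.+1 < i + j)%N ->
  D m j * gn i = gn i.-1 * D m j.
Proof.
move=> mn im; elim: j => [|j IH] jm ij; first by lia.
have [ij'|ij'] := ltnP m.+1 (i + j)%N.
  rewrite DS -mulrA gn_comm; last by lia.
  by rewrite !mulrA IH //; lia.
case: j jm ij ij' {IH} => [|j] jm ij ij'; first by lia.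
have E : (m - j = (m - j.+1).+1)%N by lia.
have Ei : i = (m - j)%N by lia.
rewrite !DS Ei -!mulrA [gn (m - j) * _]mulrA E -gn_braid ?mulrA; last by lia.
rewrite D_comm //; lia.
Qed.

Definition normal_form m (a : A) : Prop :=
  exists (k : 'I_n -> nat) (s : seq nat), s \in staircase m /\ a = torus k * gword s.

Let nf_t m a j k : in_span (normal_form m) a -> in_span (normal_form m) (a * t j ^+ k).
Proof.
move=> Ha; elim: k => [|k IH]; first by rewrite expr0 mulr1.
rewrite exprSr mulrA; apply: span_mulr IH => {Ha} x [l [s [sm ->]]].
apply: Span_gen; have [j' E] := gword_t s j.
rewrite -mulrA E mulrA torus_t.
by exists (fun i => l i + (i == j'))%N, s.
Qed.

Let nf_D m a j : (j <= m.+1)%N -> in_span (normal_form m) a ->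
  in_span (normal_form m.+1) (a * D m j).
Proof.
move=> jm; apply: span_mulr => x [l [s [sm ->]]]; apply: Span_gen.
exists l, (s ++ descending m j); split; last by rewrite gword_cat mulrA.
by apply/allpairsPdep; exists s, j; split => //; rewrite mem_iota.
Qed.

(* A run from [m] down to [b] times [g_i]: for [i < b - 1] and for [b < i] the
   generator crosses the run and falls on the smaller staircase, for
   [i = b - 1] the run gets longer, and for [i = b] the quadratic relation
   applies. *)
Let nf_g m i a : (m <= n.-1)%N -> (i < m)%N -> in_span (normal_form m) a ->
  in_span (normal_form m) (a * gn i).
Proof.
elim: m i a => [//|m IH] i a mn im; apply: span_mulr => {a} x [l [s [/allpairsPdep[s' [j [s'm]]]]]].
rewrite mem_iota add0n ltnS => /= jm -> ->.
rewrite gword_cat mulrA -/(D m j).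
have : in_span (normal_form m) (torus l * gword s') by apply: Span_gen; exists l, s'.
move: (torus l * gword s') => a Ha.
have [ijm|ijm|ijm] := ltngtP (i + j) m.
- rewrite -mulrA D_comm // mulrA; apply: nf_D => //; apply: IH => //; lia.
- have [ijm'|ijm'] := ltnP m.+1 (i + j).
    rewrite -mulrA D_braid // mulrA; apply: nf_D => //; apply: IH => //; lia.
  case: j jm ijm ijm' => [|j] jm ijm ijm'; first lia.
  have -> : i = (m - j)%N by lia.
  have [|u [b [c E]]] := @gn_sqr (m - j); first lia.
  rewrite DS -!mulrA E mulrDr mulr1 mulrDr -!scalerAr.
  apply: Span_D; first by apply: nf_D => //; lia.
  rewrite !mulr_sumr; apply/Span_Z/span_sum => r.
  rewrite !mulrA -[a * _ * _]mulrA -DS; do 2!apply: nf_t.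
  by apply: nf_D.
- have -> : i = (m - j)%N by lia.
  rewrite -mulrA -DS; apply: nf_D => //; lia.
Qed.

Lemma in_normal_form_span_g i a : in_span (normal_form n.-1) a ->
  in_span (normal_form n.-1) (a * g i).
Proof. by rewrite -gnE; apply: nf_g. Qed.

Lemma in_normal_form_span_t j a : in_span (normal_form n.-1) a ->
  in_span (normal_form n.-1) (a * t j).
Proof. by rewrite -[t j]expr1; apply: nf_t. Qed.

Lemma in_normal_form_span_1 : in_span (normal_form n.-1) 1.
Proof.
apply: Span_gen; exists (fun=> 0%N), [::]; split; first exact: nil_in_staircase.
by rewrite /gword big_nil mulr1 /torus big1.
Qed.

(** The exponents of the [t_j] are reduced modulo [d], so that the size of the
    family is that of the basis. *)
Lemma normal_form_family : (0 < d)%N ->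
  exists X : {ffun 'I_n -> 'I_d} * 'I_(n.-1.+1`!) -> A,
    forall x, normal_form n.-1 x -> exists j, x = X j.
Proof.
move=> d_gt0; exists (fun kj : {ffun 'I_n -> 'I_d} * 'I_(n.-1.+1`!) =>
  torus (fun i => kj.1 i) * gword (nth [::] (staircase n.-1) kj.2)).
move=> x [k [s [sn ->]]].
have hs : (index s (staircase n.-1) < n.-1.+1`!)%N by rewrite -size_staircase index_mem.
exists ([ffun j => Ordinal (ltn_pmod (k j) d_gt0)], Ordinal hs); rewrite /= nth_index //.
by rewrite torus_mod; congr (_ * _); apply: eq_bigr => j _; rewrite ffunE.
Qed.

End NormalForms.

(** * The form on the Yokonuma-Hecke algebra *)

Section Yokonuma.
Variables (L : comUnitRingType) (q : L) (d n : nat).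
Local Notation Y := (yokonuma q d n).
Local Notation index := ({ffun 'I_n -> 'I_d} * 'S_n)%type.

(** The algebra is spanned by products of generators, built one factor at a time
    on the right. *)
Lemma yh_ind (P : Y -> Prop) :
    P 1 -> (forall a b, P a -> P b -> P (a + b)) -> (forall c a, P a -> P (c *: a)) ->
    (forall a i, P a -> P (a * yh_g q d i)) -> (forall a j, P a -> P (a * yh_t q d j)) ->
  forall a, P a.
Proof.
have pi0 : @yh_pi L q d n 0 = 0 by exact: raddf0.
move=> P1 PD PZ Pg Pt a; rewrite -[a]yh_reprK [yh_repr a]monalgE.
rewrite (big_morph (@yh_pi L q d n) (@yh_piD L q d n) pi0).
apply: big_ind => [|//|m _]; first by rewrite -(scale0r 1); apply: PZ.
have -> : << (yh_repr a)@_m *g m >> = (yh_repr a)@_m *: << m >> :> {malg L[_]}.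
  by rewrite -mul_malgC malgM_def fgmulUU mul1m mulr1.
rewrite yh_piZ; apply: PZ; rewrite -[m]fmK.
elim/last_ind: (m : seq _) => [|s x IH]; first by rewrite -fmoneE.
have -> : << FMonom (rcons s x) >> = << FMonom s >> * malg_gen L x :> {malg L[_]}.
  rewrite malg_gen.unlock malgM_def fgmulUU mulr1; congr << _ >>.
  by apply/val_inj; rewrite /= fmM fmU cats1.
rewrite yh_piM; case: x => x; [exact: Pg | exact: Pt].
Qed.

Lemma yh_tmonM k l : yh_tmon q d k * yh_tmon q d l = yh_tmon q d (fun j => k j + l j)%N :> Y.
Proof. exact: (torusM (@yh_relations L q d n)). Qed.

Lemma yh_tmon0 : yh_tmon q d (fun=> 0%N) = 1 :> Y.
Proof. by rewrite /yh_tmon big1. Qed.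

Lemma yh_gw1 : yh_gw q d 1%g = 1 :> Y.
Proof.
suff /size0nil E : size (reduced_word (1%g : 'S_n)) = 0%N by rewrite /yh_gw E big_nil.
apply/eqP; rewrite -leqn0; apply: (reduced_reduced_word (s' := [::])).
by rewrite reduced_word_perm word_perm_nil.
Qed.

Hypothesis d_gt0 : (0 < d)%N.
Hypothesis n_gt0 : (0 < n)%N.

Lemma yh_spanning_family : exists e : {ffun 'I_n -> 'I_d} * 'I_(n.-1.+1`!) -> Y,
  forall a, exists c, a = \sum_j c j *: e j.
Proof.
have [e eP] := normal_form_family (@yh_relations L q d n) d_gt0.
exists e => a; apply: (span_family eP); elim/yh_ind: a => [|a b|c a|a i|a j].
- exact: in_normal_form_span_1.
- exact: Span_D.
- exact: Span_Z.
- exact: (in_normal_form_span_g (@yh_relations L q d n)).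
- exact: (in_normal_form_span_t (@yh_relations L q d n)).
Qed.

Variable z : L.
Hypothesis d_unit : d%:R \is a @GRing.unit L.
Hypothesis z_order : z ^+ d = 1.
Hypothesis z_sum : forall m, \sum_(a < d) z ^+ (a * m) = d%:R *+ (d %| m).
Local Notation avg_tau := (avg_tau z).

Definition yh_dual (kw : index) : Y :=
  yh_gw q d kw.2^-1%g * yh_tmon q d (fun j => d - kw.1 j)%N.

(** Both this lemma and the next one are instances of [avg_tauE]; that they have
    the same value is the symmetry of the form. *)
Lemma avg_tau_dual x y : avg_tau (yh_dual x * yh_basis q y) = (x == y)%:R.
Proof.
rewrite /yh_dual /yh_basis -mulrA [X in _ * X]mulrA yh_tmonM.
have := avg_tauE q d_unit z_order z_sum (fun=> 0%N) (fun j => d - x.1 j + y.1 j)%N (fun=> 0%N).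
move=> /(_ x.2^-1%g y.2); rewrite yh_tmon0 mul1r mulr1 mulrA => ->.
case: x y => [k w] [l w'] /=; rewrite invgK xpair_eqE andbC; congr (_ && _)%:R.
apply/forallP/eqP => [H|-> j]; last by rewrite add0n addn0 subnK // ltnW.
apply/ffunP => j; apply/esym/eqP; have := H (w j).
by rewrite permK add0n addn0 addnC dvdn_add_subr.
Qed.

Lemma avg_tau_dual_r x y : avg_tau (yh_basis q x * yh_dual y) = (y == x)%:R.
Proof.
rewrite /yh_dual /yh_basis mulrA.
have := avg_tauE q d_unit z_order z_sum (fun j => x.1 j : nat) (fun=> 0%N) (fun j => d - y.1 j)%N.
move=> /(_ x.2 y.2^-1%g); rewrite yh_tmon0 mulr1 => ->.
case: x y => [k w] [l w'] /=; rewrite (inj_eq invg_inj) (eq_sym (l, w')) xpair_eqE andbC.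
congr (_ && _)%:R.
apply/forallP/eqP => [H|-> j]; last by rewrite addn0 subnKC // ltnW.
by apply/ffunP => j; apply/eqP; have := H j; rewrite addn0 dvdn_add_subr.
Qed.

Lemma avg_tau_mull a : scalar (fun b => avg_tau (a * b : Y)).
Proof. by move=> c x y; rewrite mulrDr -scalerAr avg_tau_scalar. Qed.

Lemma avg_tau_mulr b : scalar (fun a => avg_tau (a * b : Y)).
Proof. by move=> c x y; rewrite mulrDl -scalerAl avg_tau_scalar. Qed.

(** The duals supply the functionals, and the staircase family the spanning
    family, of the right size since there are [n!] permutations. *)
Lemma yh_basisP : is_basis (yh_basis q : index -> Y).
Proof.
have [e eP] := yh_spanning_family.
apply: (basis_of_biorthogonal (psi := fun x a => avg_tau (yh_dual x * a)) _ _ eP avg_tau_dual).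
  by rewrite !card_prod card_ord card_Sn prednK.
by move=> x; apply: avg_tau_mull.
Qed.

Lemma yh_basis_span (a : Y) : exists c : index -> L, a = \sum_x c x *: yh_basis q x.
Proof. by have [c []] := yh_basisP a; exists c. Qed.

Lemma yh_dualP : is_basis yh_dual.
Proof.
apply: (basis_of_biorthogonal (psi := fun x a => avg_tau (a * yh_basis q x))
    _ _ yh_basis_span) => //.
- by move=> x; apply: avg_tau_mulr.
- by move=> x y; rewrite avg_tau_dual eq_sym.
Qed.

Lemma yh_tauE (a : Y) : yh_tau q a = avg_tau a.
Proof.
rewrite {2}(basis_coordK yh_basisP a) scalar_sum; last exact: avg_tau_scalar.
apply: eq_bigr => [[k w] _]; congr (_ * _).
have := avg_tauE q d_unit z_order z_sum (fun j => k j : nat) (fun=> 0%N) (fun=> 0%N).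
move=> /(_ w 1%g); rewrite yh_tmon0 yh_gw1 !mulr1 /yh_basis /= => ->.
rewrite -[1%g in LHS]invg1 (can2_eq invgK invgK) /=.
under [in RHS]eq_forallb do rewrite !addn0.
by case: ifP.
Qed.

Lemma avg_tauC (a b : Y) : avg_tau (a * b) = avg_tau (b * a).
Proof.
have [c [-> _]] := yh_basisP a; have [c' [-> _]] := yh_dualP b.
rewrite (scalar_sum (avg_tau_mulr _)) (scalar_sum (avg_tau_mull _)).
apply: eq_bigr => x _; congr (_ * _).
rewrite (scalar_sum (avg_tau_mull _)) (scalar_sum (avg_tau_mulr _)).
by apply: eq_bigr => y _; rewrite avg_tau_dual avg_tau_dual_r.
Qed.

Theorem yh_tau_gram (w w' : 'S_n) (k l : {ffun 'I_n -> 'I_d}) :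
  yh_tau q (yh_tmon q d (fun j => k j) * yh_gw q d w * yh_gw q d w' * yh_tmon q d (fun j => l j))
    = if (w^-1%g == w') && [forall j, (d %| k j + l j)%N] then 1 else 0.
Proof.
have := avg_tauE q d_unit z_order z_sum (fun j => k j : nat) (fun=> 0%N) (fun j => l j : nat).
move=> /(_ w w'); rewrite yh_tmon0 mulr1 yh_tauE => ->.
under eq_forallb do rewrite addn0.
by case: ifP.
Qed.

Theorem yh_tau_dual_basis : dual_basis (yh_tau q) (yh_basis q) yh_dual.
Proof.
split; [exact: yh_basisP | exact: yh_dualP | move=> x y].
by rewrite yh_tauE avg_tau_dual.
Qed.

Theorem yh_tau_symmetrising : symmetrising_form (yh_tau q : Y -> L).
Proof.
have -> : yh_tau q = avg_tau :> (Y -> L) by apply/funext/yh_tauE.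
split; [exact: avg_tau_scalar | exact: avg_tauC |].
have enum_eq (i j : 'I_#|{: index}|) : (enum_val i == enum_val j) = (i == j).
  exact: (inj_eq enum_val_inj).
exists #|{: index}|, (yh_dual \o enum_val), (yh_basis q \o enum_val); split.
- apply: (basis_of_biorthogonal (psi := fun i a => avg_tau (a * yh_basis q (enum_val i)))
    _ _ yh_basis_span).
  + by rewrite card_ord.
  + by move=> i; apply: avg_tau_mulr.
  + by move=> i j; rewrite avg_tau_dual enum_eq eq_sym.
- apply: (basis_of_biorthogonal (psi := fun i a => avg_tau (yh_dual (enum_val i) * a))
    _ _ yh_basis_span).
  + by rewrite card_ord.
  + by move=> i; apply: avg_tau_mull.
  + by move=> i j; rewrite avg_tau_dual enum_eq.
- rewrite (_ : \matrix_(i, j) _ = 1%:M) ?det1 ?unitr1 //.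
  by apply/matrixP => i j; rewrite !mxE avg_tau_dual enum_eq.
Qed.

End Yokonuma.

(** * Roots of unity and Laurent polynomials *)

(** [X^d - 1] is separable, so it has [d] distinct roots, and a finite group of
    roots of unity is cyclic. *)
Lemma prim_root_exists (K : closedFieldType) d : (d%:R : K) != 0 ->
  exists w : K, d.-primitive_root w.
Proof.
move=> d_neq0; have d_gt0 : (0 < d)%N by case: d d_neq0 => //; rewrite eqxx.
pose p : {poly K} := 'X^d - 1; have [r Dp] := closed_field_poly_normal p.
move: Dp; rewrite (monicP _) ?monicXnsubC // scale1r => Dp.
have sz_r : (d < (size r).+1)%N by rewrite -(size_prod_XsubC r id) -Dp size_XnsubC.
have rn1 : all d.-unity_root r by apply/allP => w; rewrite -root_prod_XsubC -Dp.
have Ur : uniq r.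
  by rewrite -separable_prod_XsubC -Dp separable_Xn_sub_1.
have /hasP[w _ prim_w] := has_prim_root d_gt0 rn1 Ur sz_r.
by exists w.
Qed.

Lemma prim_root_sum (F : fieldType) (d : nat) (w : F) : d.-primitive_root w ->
  forall m, \sum_(a < d) w ^+ (a * m) = d%:R *+ (d %| m).
Proof.
move=> prim_w m.
under eq_bigr do rewrite mulnC exprM.
have [dm|dm] := boolP (d %| m)%N.
  rewrite (eqP (_ : w ^+ m == 1)) -?(prim_order_dvd prim_w) //.
  by under eq_bigr do rewrite expr1n; rewrite sumr_const card_ord.
apply: (mulfI (x := w ^+ m - 1)); first by rewrite subr_eq0 -(prim_order_dvd prim_w).
by rewrite -subrX1 -exprM mulnC exprM (prim_expr_order prim_w) expr1n subrr mulr0.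
Qed.

Section LaurentConstants.
Variable K : fieldType.

Fact laurent_const_subproof (c : K) : tofrac c%:P \in @laurent_pred K.
Proof. by apply/asboolP; exists c%:P, 0%N; rewrite expr0 divr1. Qed.

Definition laurent_const (c : K) : laurent K := Laurent (laurent_const_subproof c).

Fact laurent_const_zmod : zmod_morphism laurent_const.
Proof. by move=> a b; apply: val_inj; rewrite /= polyCB tofracB. Qed.

Fact laurent_const_monoid : monoid_morphism laurent_const.
Proof.
split; first by apply: val_inj; rewrite /= tofrac1.
by move=> a b; apply: val_inj; rewrite /= polyCM tofracM.
Qed.

HB.instance Definition _ :=
  GRing.isZmodMorphism.Build K (laurent K) laurent_const laurent_const_zmod.
HB.instance Definition _ :=
  GRing.isMonoidMorphism.Build K (laurent K) laurent_const laurent_const_monoid.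

End LaurentConstants.

Theorem proposition10 (R : realType) (d n : nat) (hd : (0 < d)%N) (hn : (0 < n)%N) :
  let q := laurent_q R[i] in
  [/\ forall (w w' : 'S_n) (k l : {ffun 'I_n -> 'I_d}),
        yh_tau q (yh_tmon q d (fun j => k j) * yh_gw q d w * yh_gw q d w' *
                  yh_tmon q d (fun j => l j)) =
          if (w^-1%g == w') && [forall j, (d %| k j + l j)%N] then 1 else 0,
      symmetrising_form (yh_tau q : yokonuma q d n -> laurent R[i]) &
      dual_basis (yh_tau q) (yh_basis q)
        (fun kw : {ffun 'I_n -> 'I_d} * 'S_n =>
          yh_gw q d kw.2^-1%g * yh_tmon q d (fun j => d - kw.1 j)%N)].
Proof.
move=> q.
have d_neq0 : (d%:R : R[i]) != 0 by rewrite pnatr_eq0 -lt0n.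
have [w prim_w] := prim_root_exists d_neq0.
pose z := laurent_const w.
have d_unit : (d%:R : laurent R[i]) \is a GRing.unit.
  by rewrite -(rmorph_nat (@laurent_const _)) rmorph_unit // unitfE.
have z_order : z ^+ d = 1 by rewrite -rmorphXn (prim_expr_order prim_w) rmorph1.
have z_sum m : \sum_(a < d) z ^+ (a * m) = d%:R *+ (d %| m).
  rewrite -(rmorph_nat (@laurent_const _)) -rmorphMn -(prim_root_sum prim_w) rmorph_sum.
  by apply: eq_bigr => a _; rewrite rmorphXn.
split.
- by move=> v v' k l; apply: (yh_tau_gram _ _ _ d_unit z_order z_sum).
- exact: (yh_tau_symmetrising _ _ _ d_unit z_order z_sum).
- exact: (yh_tau_dual_basis _ _ _ d_unit z_order z_sum).
Qed.
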